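(* Let $\kappa=[2\ell-1]$ for some $\ell\in\mathbb Z$, let $t=F+\check E+\kappa K^{-1}$, and define for $a\ge0$ $$\dot t^{(2a)}=\frac{t}{[2a]!}\prod_{j=-a+1}^{a-1}\bigl(t-[2j]\bigr),\qquad \dot t^{(2a+1)}=\frac{1}{[2a+1]!}\prod_{j=-a}^{a}\bigl(t-[2j]\bigr).$$ (1) Let $n\in\mathbb N$. For every integer $\lambda$ sufficiently large compared to $n$, the element $\dot t^{(n)}v^+_{2\lambda+1}$ is an $\imath$-canonical basis element of $L(2\lambda+1)$. (2) The set $\{\dot t^{(n)}\mid n\in\mathbb N\}$ is the $\imath$-canonical basis of $\mathbf U^\imath$ for odd weights, and it is an $\mathcal A$-basis of ${}_{\mathcal A}\mathbf U^\imath_{\rm odd}$.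
   Context: $q$ is an indeterminate, $\mathcal A=\mathbb Z[q,q^{-1}]$, $[n]=\frac{q^n-q^{-n}}{q-q^{-1}}$, $[n]!=[1]\cdots[n]$, $[0]!=1$. $\mathbf U$ is the $\mathbb Q(q)$-algebra generated by $E,F,K^{\pm1}$ with relations $KK^{-1}=K^{-1}K=1$, $EF-FE=\frac{K-K^{-1}}{q-q^{-1}}$, $KE=q^2EK$, $KF=q^{-2}FK$; $\check E=q^{-1}EK^{-1}$, $F^{(n)}=F^n/[n]!$. $\mathbf U^\imath$ is the $\mathbb Q(q)$-subalgebra of $\mathbf U$ generated by $t$, and $\psi_\imath$ is the ring involution of $\mathbf U^\imath$ fixing $t$ and sending $q\mapsto q^{-1}$. For $\mu\in\mathbb N$, $L(\mu)$ is the simple $\mathbf U$-module of highest weight $\mu$ with highest weight vector $v^+_\mu$; it has basis $\{F^{(a)}v^+_\mu\}_{0\le a\le\mu}$ whose $\mathcal A$-span is $L(\mu)_{\mathcal A}$. The $\imath$-bar involution $\psi_\imath$ on $L(\mu)$ is the $q\mapsto q^{-1}$ semilinear map with $\psi_\imath(xv^+_\mu)=\psi_\imath(x)v^+_\mu$ for $x\in\mathbf U^\imath$. For $0\le a\le\mu$ the $\imath$-canonical basis element $b^\mu_a\in L(\mu)$ is the unique element with $\psi_\imath(b^\mu_a)=b^\mu_a$ and $b^\mu_a\in F^{(a)}v^+_\mu+\sum_{0\le r<a}q^{-1}\mathbb Z[q^{-1}]F^{(r)}v^+_\mu$ (these exist by Bao–Wang). ${}_{\mathcal A}\mathbf U^\imath_{\rm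 odd}=\{x\in\mathbf U^\imath: xv\in L(\mu)_{\mathcal A}\ \forall v\in L(\mu)_{\mathcal A},\ \forall \mu\in 2\mathbb N+1\}$. The $\imath$-canonical basis of $\mathbf U^\imath$ for odd weights (Bao–Wang) is the family $\{B_n\}_{n\in\mathbb N}\subset{}_{\mathcal A}\mathbf U^\imath_{\rm odd}$ characterized by: for each $n$, $B_nv^+_{2\lambda+1}=b^{2\lambda+1}_n$ for all $\lambda\gg0$.
   Formalization: For a = 0 the formula with an empty product would give ṫ^{(0)} = t = ṫ^{(1)}, which makes part (2) false (1 would not be in the span); the formal statement sets ṫ^{(0)} = 1, and all other ṫ^{(n)} are as written. *)

(* Defs.v *)
From HB Require Import structures.
From mathcomp Require Import all_boot all_order all_algebra.
From mathcomp Require Import generic_quotient fraction.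
Set Implicit Arguments. Unset Strict Implicit. Unset Printing Implicit Defensive.
Import Order.TTheory GRing.Theory Num.Theory.
Local Open Scope ring_scope.

Definition Qq : fieldType := {fraction {poly rat}}.

Definition qq : Qq := tofrac ('X : {poly rat}).

Definition ev_qinv (p : {poly rat}) : Qq :=
  (map_poly (fun c : rat => tofrac (c%:P : {poly rat})) p).[qq^-1].

Definition barQ (x : Qq) : Qq :=
  let r := repr x in ev_qinv (frac r).1 / ev_qinv (frac r).2.

Definition qint (n : int) : Qq := (qq ^ n - qq ^ (- n)) / (qq - qq^-1).
Definition qfact (n : nat) : Qq := \prod_(1 <= i < n.+1) qint i%:Z.

Definition in_A (x : Qq) : Prop :=
  exists (p : {poly int}) (k : nat),
    x = (map_poly (fun z : int => z%:~R : Qq) p).[qq] / qq ^+ k.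

Definition in_qinvZqinv (x : Qq) : Prop :=
  exists p : {poly int},
    x = qq^-1 * (map_poly (fun z : int => z%:~R : Qq) p).[qq^-1].

Definition kappa (l : int) : Qq := qint (2 * l - 1).

(* The simple module L(mu), mu : nat, is modelled as column vectors of size
   mu+1: coordinate a is the coefficient of F^{(a)} v^+_mu.  In this basis
     F  F^{(j)} v = [j+1] F^{(j+1)} v,
     E  F^{(j)} v = [mu-j+1] F^{(j-1)} v,
     K^{-1} F^{(j)} v = q^{-(mu-2j)} F^{(j)} v,
   so t = F + q^{-1} E K^{-1} + kappa K^{-1} acts by the matrix tmat. *)
Definition tmat (l : int) (mu : nat) : 'M[Qq]_(mu.+1) :=
  \matrix_(i, j)
    ((if (i : nat) == (j : nat).+1 then qint (j%:Z + 1) else 0)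
   + (if (i : nat).+1 == (j : nat)
      then qq ^ (- 1 - (mu%:Z - 2 * j%:Z)) * qint (mu%:Z - j%:Z + 1) else 0)
   + (if (i : nat) == (j : nat)
      then kappa l * qq ^ (- (mu%:Z - 2 * j%:Z)) else 0)).

Definition vplus (mu : nat) : 'cV[Qq]_(mu.+1) := delta_mx 0 0.

(* U^i is the subalgebra generated by t; it is the polynomial algebra
   Q(q)[t], so elements of U^i are represented by polynomials x : {poly Qq}
   (x stands for x(t)).  Action of x on L(mu): *)
Definition act (l : int) (mu : nat) (x : {poly Qq}) (v : 'cV[Qq]_(mu.+1)) :
  'cV[Qq]_(mu.+1) := horner_mx (tmat l mu) x *m v.

Arguments act l mu x v : clear implicits.

Definition psi_poly (x : {poly Qq}) : {poly Qq} := map_poly barQ x.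

(* b in L(mu) is psi_i-fixed: writing b = x v^+ (x in U^i),
   psi_i(b) := psi_i(x) v^+ equals b *)
Definition psi_fixed (l : int) (mu : nat) (b : 'cV[Qq]_(mu.+1)) : Prop :=
  exists x : {poly Qq},
    act l mu x (vplus mu) = b /\ act l mu (psi_poly x) (vplus mu) = b.

Arguments psi_fixed l mu b : clear implicits.

Definition is_icb (l : int) (mu a : nat) (b : 'cV[Qq]_(mu.+1)) : Prop :=
  (a <= mu)%N /\ psi_fixed l mu b /\
  (forall r : 'I_(mu.+1),
      ((r : nat) == a -> b r 0 = 1) /\
      ((r < a)%N -> in_qinvZqinv (b r 0)) /\
      ((a < r)%N -> b r 0 = 0)).

Arguments is_icb l mu a b : clear implicits.

Definition in_LA (mu : nat) (v : 'cV[Qq]_(mu.+1)) : Prop :=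
  forall i : 'I_(mu.+1), in_A (v i 0).

Definition in_AUodd (l : int) (x : {poly Qq}) : Prop :=
  forall mu : nat, odd mu ->
    forall v : 'cV[Qq]_(mu.+1), in_LA v -> in_LA (act l mu x v).

Definition tdot (n : nat) : {poly Qq} :=
  let a := n./2 in
  if n == 0%N then 1 else
  if odd n then
    (qfact n)^-1 *: \prod_(i < (2 * a).+1) ('X - (qint (2 * (i%:Z - a%:Z)))%:P)
  else
    (qfact n)^-1 *: ('X * \prod_(i < (2 * a).-1)
                             ('X - (qint (2 * (i%:Z - a%:Z + 1)))%:P)).

Definition is_icanonical_basis_odd (l : int) (B : nat -> {poly Qq}) : Prop :=
  forall n : nat, in_AUodd l (B n) /\
    exists L0 : nat, forall lam : nat, (L0 <= lam)%N ->
      is_icb l (2 * lam).+1 n (act l (2 * lam).+1 (B n) (vplus (2 * lam).+1)).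

Definition is_A_basis_AUodd (l : int) (B : nat -> {poly Qq}) : Prop :=
  (forall n, in_AUodd l (B n)) /\
  (forall (N : nat) (c : nat -> Qq), (forall i, in_A (c i)) ->
      \sum_(i < N) c i *: B i = 0 -> forall i, (i < N)%N -> c i = 0) /\
  (forall x, in_AUodd l x ->
      exists (N : nat) (c : nat -> Qq), (forall i, in_A (c i)) /\
        x = \sum_(i < N) c i *: B i).

(* Main.v *)
(** The idea is to pass from L(mu) to L(mu + 1) inside L(mu) (x) L(1).  If t
    acts on N by T, then it acts on N (x) L(1) by the block matrix
    M = [T/q, 1; 1, qT].  Let e_n and d_n be the divided powers attached to
    the spectra {[2j]} and {[2j+1]}; both satisfy
      [n+1] p_{n+1} = X p_n - c_n [n] p_{n-1},
    with c_n = 1 for n even (for e), resp. for n odd (for d), and c_n = 0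
    otherwise.  By induction on n,
      e_n(M) = [q^-n d_n + c_n q^(1-n) d_{n-2},  d_{n-1};
                d_{n-1},  q^n d_n + c_n q^(n-1) d_{n-2}]  at T,
    and likewise with e and d exchanged.  Since L(mu + 1) is a direct summand
    of L(mu) (x) L(1) over Z[q,q^-1], induction on mu gives integrality.  The
    second row, applied to the highest weight vector, gives
      coef(F^(r), p_n v_mu) = coef(v_{mu-r}, p'_{n-r} v_{mu-r}),
    p' being e or d according to parity, and the first row gives a recursion in
    mu for the coefficient of v_mu itself, which forces it into q^-1 Z[q^-1]
    as soon as n > 0 and mu is large. *)

Require Import Defs.
From HB Require Import structures.
From mathcomp Require Import all_boot all_order all_algebra.
From mathcomp Require Import generic_quotient fraction.
From mathcomp Require Import ring zify.
Set Implicit Arguments. Unset Strict Implicit. Unset Printing Implicit Defensive.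
Import Order.TTheory GRing.Theory Num.Theory.
Local Open Scope ring_scope.

Lemma odd_eqN n b : (odd n == ~~ b) = ~~ (odd n == b).
Proof. by case: (odd n) b => [] []. Qed.

Lemma odd_eqS n b : (odd n.+1 == b) = ~~ (odd n == b).
Proof. by rewrite oddS; case: (odd n) b => [] []. Qed.

(** * Divided powers over a field with a parameter q *)

Section QuantumIntegers.

Variables (F : fieldType) (q : F).
Hypotheses (q_neq0 : q != 0) (q_nonroot : forall n, (0 < n)%N -> q ^+ n != 1).

Definition qnum (n : int) : F := (q ^ n - q ^ (- n)) / (q - q^-1).

Lemma q2_sub1_neq0 : q ^+ 2 - 1 != 0.
Proof. by rewrite subr_eq0 q_nonroot. Qed.

Lemma q_subV_neq0 : q - q^-1 != 0.
Proof.
have -> : q - q^-1 = (q ^+ 2 - 1) / q by field.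
by rewrite mulf_neq0 ?invr_neq0 ?q2_sub1_neq0.
Qed.

Lemma qz_neq0 (n : int) : q ^ n != 0.
Proof. by rewrite expfz_neq0. Qed.

Lemma qnum0 : qnum 0 = 0.
Proof. by rewrite /qnum oppr0 subrr mul0r. Qed.

Lemma qnum1 : qnum 1 = 1.
Proof. by rewrite /qnum expr1z exprN1 divff ?q_subV_neq0. Qed.

Lemma qnumN (n : int) : qnum (- n) = - qnum n.
Proof. by rewrite /qnum opprK -mulNr opprB. Qed.

Lemma qnumD1 (n : int) : qnum (n + 1) = q ^ n + q^-1 * qnum n.
Proof.
rewrite /qnum opprD !expfzDr // -!invr_expz expr1z.
by field; rewrite q_neq0 qz_neq0 q2_sub1_neq0.
Qed.

Lemma qnumD1r (n : int) : qnum (n + 1) = q ^ (- n) + q * qnum n.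
Proof.
rewrite /qnum opprD !expfzDr // -!invr_expz expr1z.
by field; rewrite q_neq0 qz_neq0 q2_sub1_neq0.
Qed.

Lemma qnum_neq0 n : qnum n.+1 != 0.
Proof.
rewrite mulf_neq0 ?invr_neq0 ?q_subV_neq0 // subr_eq0.
apply/negP => /eqP /(congr1 ( *%R (q ^+ n.+1))).
rewrite -invr_expz mulfV ?expf_neq0 // -[q ^ _]/(q ^+ n.+1) -exprD => /eqP.
by rewrite (negPf (@q_nonroot (n.+1 + n.+1) isT)).
Qed.

Lemma PoszS1 n : n.+1%:Z = n%:Z + 1.
Proof. by rewrite -addn1 PoszD. Qed.

Lemma PoszSB1 n : n.+1%:Z - 1 = n%:Z.
Proof. by rewrite PoszS1 addrK. Qed.

(* [idp false] is attached to the spectrum {[2j]} (these are the [tdot n]) and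
   [idp true] to {[2j+1]}.  It is locked because [linearZ] would otherwise unfold
   [idp b n.+1] to a scaled polynomial. *)
Fixpoint idp_unlocked (b : bool) (n : nat) : {poly F} :=
  match n with
  | 0 => 1
  | n1.+1 => (qnum n1.+1)^-1 *: ('X * idp_unlocked b n1 -
      match n1 with
      | 0 => 0
      | n2.+1 => if odd n1 == b then qnum n1 *: idp_unlocked b n2 else 0
      end)
  end.

Definition idp := locked idp_unlocked.

Lemma idp0 b : idp b 0 = 1.
Proof. by rewrite /idp -lock. Qed.

(** The guard gives divided powers of negative index the value 0; truncated subtraction alone would
    give [idp b 0], which is 1. *)
Definition idps (b : bool) (j n : nat) : {poly F} :=
  if (j <= n)%N then idp b (n - j) else 0.

Lemma idps1S b n : idps b 1 n.+1 = idp b n.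
Proof. by rewrite /idps subn1. Qed.

Lemma idps2S b n : idps b 2 n.+1 = idps b 1 n.
Proof. by rewrite /idps ltnS subSS. Qed.

Lemma idp_rec b n :
  qnum n.+1 *: idp b n.+1 =
  'X * idp b n - ((odd n == b)%:R * qnum n) *: idps b 1 n.
Proof.
rewrite /idps /idp -lock [idp_unlocked b n.+1]/= scalerA mulfV ?qnum_neq0 // scale1r; congr (_ - _).
case: n => [|n]; first by rewrite qnum0 mulr0 scale0r.
by rewrite subn1; case: eqP => _; rewrite ?mul1r // mul0r scale0r.
Qed.

Lemma mulX_idp b n :
  'X * idp b n = qnum n.+1 *: idp b n.+1 + ((odd n == b)%:R * qnum n) *: idps b 1 n.
Proof. by rewrite idp_rec subrK. Qed.

Lemma mulX_idps1 b n :
  'X * idps b 1 n =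
  qnum n *: idp b n + ((odd n != b)%:R * qnum (n%:Z - 1)) *: idps b 2 n.
Proof.
case: n => [|n]; first by rewrite /idps /= mulr0 qnum0 scale0r scaler0 add0r.
rewrite idps1S idps2S mulX_idp oddS PoszSB1.
by congr (_ + (_%:R * _) *: _); case: (odd n) b => [] [].
Qed.

(** Two indices lower the parity is again that of [n], so the recursion has no correction term and
    no third shift appears. *)
Lemma mulX_idps2 b n : odd n != b ->
  'X * idps b 2 n = qnum (n%:Z - 1) *: idps b 1 n.
Proof.
case: n => [|[|n]] nb; rewrite /idps /= ?mulr0 ?scaler0 ?subrr ?qnum0 ?scale0r //.
rewrite !subSS !subn0 mulX_idp PoszSB1; move: nb; rewrite /= negbK.
by move/negPf->; rewrite mul0r scale0r addr0.
Qed.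

(** * Intertwining the two families of divided powers *)

Section Intertwiner.

Variables (k m : nat) (T : 'M[F]_k.+1) (S : 'M[F]_m.+1) (P1 P2 : 'M[F]_(k.+1, m.+1)).
Hypotheses (P1S : P1 *m S = q^-1 *: (T *m P1) + P2)
           (P2S : P2 *m S = P1 + q *: (T *m P2)).

Let D b := fun n => horner_mx T (idp b n).
Let Ds b j := fun n => horner_mx T (idps b j n).

(* [P1] and [P2] are the two components of a map intertwining [S] with the block
   matrix [T/q, 1; 1, qT]. *)
Lemma idp_intertwine b n :
  let s : F := (odd n == b)%:R in
  P1 *m horner_mx S (idp b n) =
    (q ^+ n)^-1 *: (D (~~ b) n *m P1)
    + (s * (q / q ^+ n)) *: (Ds (~~ b) 2 n *m P1) + Ds (~~ b) 1 n *m P2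
  /\
  P2 *m horner_mx S (idp b n) =
    Ds (~~ b) 1 n *m P1
    + (q ^+ n *: (D (~~ b) n *m P2) + (s * (q^-1 * q ^+ n)) *: (Ds (~~ b) 2 n *m P2)).
Proof.
pose Q n (M : 'M[F]_m.+1) (s : F) :=
  P1 *m M = (q ^+ n)^-1 *: (D (~~ b) n *m P1)
    + (s * (q / q ^+ n)) *: (Ds (~~ b) 2 n *m P1) + Ds (~~ b) 1 n *m P2 /\
  P2 *m M = Ds (~~ b) 1 n *m P1
    + (q ^+ n *: (D (~~ b) n *m P2) + (s * (q^-1 * q ^+ n)) *: (Ds (~~ b) 2 n *m P2)).
(* The recursion calls on index [n - 1] only in this parity, and there the formula for [n - 1] has
   no correction term of its own. *)
pose Q1 n (M : 'M[F]_m.+1) := odd n == b ->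
  P1 *m M = (q / q ^+ n) *: (Ds (~~ b) 1 n *m P1) + Ds (~~ b) 2 n *m P2 /\
  P2 *m M = Ds (~~ b) 2 n *m P1 + (q^-1 * q ^+ n) *: (Ds (~~ b) 1 n *m P2).
suff: Q n (horner_mx S (idp b n)) (odd n == b)%:R /\ Q1 n (horner_mx S (idps b 1 n)).
  by case.
elim: n => [|n [[IH1 IH2] IH']].
  have e1 (c : bool) j (R : 'M[F]_j.+1) : horner_mx R (idp c 0) = 1%:M by rewrite idp0; exact: rmorph1.
  rewrite /Q /Q1 /D /Ds /idps /= !e1 !raddf0 !mul0mx !scaler0 !addr0 expr0 invr1.
  by rewrite !scale1r !mulmx1 !mul1mx add0r.
split; last first.
  move=> nb; rewrite /Ds !idps1S idps2S; move: IH1 IH2.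
  have -> : (odd n == b) = false by apply: negPf; rewrite -odd_eqS.
  rewrite !mul0r !scale0r !addr0 => -> ->.
  by rewrite exprS invfM !mulrA mulfV // mulVf // !mul1r.
have cT p : horner_mx T p *m T = horner_mx T ('X * p).
  by rewrite mulrC rmorphM /= horner_mx_X.
have cS p : horner_mx S ('X * p) = horner_mx S p *m S.
  by rewrite mulrC rmorphM /= horner_mx_X.
have RP1 p : horner_mx T p *m P1 *m S = q^-1 *: (horner_mx T ('X * p) *m P1) + horner_mx T p *m P2.
  by rewrite -mulmxA P1S mulmxDr -scalemxAr mulmxA cT.
have RP2 p : horner_mx T p *m P2 *m S = horner_mx T p *m P1 + q *: (horner_mx T ('X * p) *m P2).
  by rewrite -mulmxA P2S mulmxDr -scalemxAr mulmxA cT.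
have q0 : q ^+ n != 0 by rewrite expf_neq0.
have nSE : qnum n.+1 = qnum (n%:Z + 1) by rewrite PoszS1.
have fS : horner_mx S (idp b n.+1) = (qnum n.+1)^-1 *: (horner_mx S (idp b n) *m S
   - ((odd n == b)%:R * qnum n) *: horner_mx S (idps b 1 n)).
  rewrite -cS -linearZ -linearB -idp_rec [in RHS]linearZ /= scalerA mulVf ?scale1r //.
  exact: qnum_neq0.
have nz : qnum (n%:Z + 1) != 0 by rewrite -nSE qnum_neq0.
have vE : qnum n = (q ^+ n - (q ^+ n)^-1) / (q - q^-1) by rewrite /qnum -invr_expz.
have uE : qnum (n%:Z + 1) = (q ^+ n * q - (q ^+ n * q)^-1) / (q - q^-1).
  by rewrite /qnum -!invr_expz expfzDr.
have wE : qnum (n%:Z - 1) = (q ^+ n / q - (q ^+ n / q)^-1) / (q - q^-1).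
  by rewrite /qnum -!invr_expz expfzDr.
have nzE : q * q - 1 != 0 := q2_sub1_neq0.
have hZ a p : horner_mx T (a *: p) = a *: horner_mx T p := horner_mxZ T a p.
have h0 : horner_mx T ('X * idp (~~ b) n) = qnum n.+1 *: horner_mx T (idp (~~ b) n.+1)
    + ((~~ (odd n == b))%:R * qnum n) *: horner_mx T (idps (~~ b) 1 n).
  by rewrite mulX_idp odd_eqN rmorphD /= !hZ.
have h1 : horner_mx T ('X * idps (~~ b) 1 n) = qnum n *: horner_mx T (idp (~~ b) n)
    + ((~~ ~~ (odd n == b))%:R * qnum (n%:Z - 1)) *: horner_mx T (idps (~~ b) 2 n).
  by rewrite mulX_idps1 odd_eqN rmorphD /= !hZ.
have h2 : odd n == b -> horner_mx T ('X * idps (~~ b) 2 n) =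
    qnum (n%:Z - 1) *: horner_mx T (idps (~~ b) 1 n).
  by move=> nb; rewrite mulX_idps2 ?odd_eqN ?nb // hZ.
rewrite /Q fS odd_eqS /D /Ds !idps1S !idps2S -!scalemxAr !mulmxBr !mulmxA IH1 IH2 -!scalemxAr.
rewrite !mulmxDl -!scalemxAl !RP1 !RP2 /Ds h0 h1 nSE.
move: h2 IH'; rewrite /Q1 /Ds {RP1 RP2 IH1 IH2 h0 h1 cT cS fS}.
move: (horner_mx T (idp (~~ b) n.+1)) (horner_mx T (idp (~~ b) n))
  (horner_mx T (idps (~~ b) 1 n)) (horner_mx T (idps (~~ b) 2 n)) => A A0 A1 A2.
have gen (x1 x2 : 'M[F]_(k.+1, m.+1)) : qnum (n%:Z + 1) *: x2 = x1 ->
  (qnum (n%:Z + 1))^-1 *: x1 = x2 by move=> <-; rewrite scalerA mulVf ?scale1r.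
(* In either parity both rows, multiplied by $[n+1]$, are entrywise linear identities with
   coefficients rational in [q] and [q ^+ n]. *)
case: (odd n == b) => /= [/(_ isT) -> /(_ isT) [-> ->] | _ _];
  rewrite exprS !mulmxDl -!scalemxAl;
  move: (A *m P1) (A *m P2) (A0 *m P1) (A0 *m P2) (A1 *m P1) (A1 *m P2) (A2 *m P1) (A2 *m P2)
    => x1 x2 x3 x4 x5 x6 x7 x8;
  split; apply: gen; apply/matrixP => i j; rewrite !mxE vE uE wE.
- by field; rewrite q_neq0 q0 q2_sub1_neq0.
- by field; rewrite q_neq0 q0 q2_sub1_neq0.
- by rewrite !mul0r !mul1r; field; rewrite q_neq0 q0 nzE.
- by rewrite !mul0r !mul1r; field; rewrite q_neq0 q0 nzE.
Qed.

End Intertwiner.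

(** * Values at quantum integers *)

Lemma horner_mx_scalar (a : F) (n : nat) (p : {poly F}) :
  horner_mx (a%:M : 'M_n.+1) p = (p.[a])%:M.
Proof.
elim/poly_ind: p => [|p c IHp]; first by rewrite rmorph0 horner0 raddf0.
rewrite rmorphD rmorphM /= horner_mx_X horner_mx_C IHp hornerMXaddC raddfD /=.
by rewrite scalar_mxM.
Qed.

(* At a scalar, the intertwining relations say that (1, x) is an eigenvector of
   [[z]/q, 1; 1, q [z]] with eigenvalue y. *)
Lemma horner_idp_shift b n (z : int) (x y : F) :
  y = q^-1 * qnum z + x -> x * y = 1 + q * (qnum z * x) ->
  (idp b n).[y] = (q ^+ n)^-1 * (idp (~~ b) n).[qnum z]
    + ((odd n == b)%:R * (q / q ^+ n)) * (idps (~~ b) 2 n).[qnum z]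
    + (idps (~~ b) 1 n).[qnum z] * x.
Proof.
move=> yE xyE.
have H1 : (1 : 'M[F]_1) *m y%:M = q^-1 *: ((qnum z)%:M *m (1 : 'M[F]_1)) + x%:M.
  by rewrite mul1mx mulmx1 yE raddfD /= scale_scalar_mx.
have H2 : (x%:M : 'M[F]_1) *m y%:M = 1 + q *: ((qnum z)%:M *m (x%:M : 'M[F]_1)).
  by rewrite -!scalar_mxM xyE raddfD /= scale_scalar_mx.
have [E _] := idp_intertwine H1 H2 b n.
move/matrixP/(_ 0 0): E; rewrite !horner_mx_scalar mul1mx !mulmx1 -!scalar_mxM !mxE.
by rewrite !mulr1n.
Qed.

(** The matrix $[[z]/q, 1; 1, q[z]]$ has eigenvalues $[z+1]$ and $[z-1]$; the eigenvector for the
    first is $(1, q^z)$. *)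
Lemma horner_idp_up b n (z : int) :
  (idp b n).[qnum (z + 1)] = (q ^+ n)^-1 * (idp (~~ b) n).[qnum z]
    + ((odd n == b)%:R * (q / q ^+ n)) * (idps (~~ b) 2 n).[qnum z]
    + (idps (~~ b) 1 n).[qnum z] * q ^ z.
Proof.
apply: horner_idp_shift; first by rewrite qnumD1 addrC.
by rewrite qnumD1r mulrDr -expfzDr // subrr expr0z mulrCA (mulrC (qnum z)).
Qed.

(** The eigenvector for $[z-1]$ is $(1, -q^{-z})$. *)
Lemma horner_idp_down b n (z : int) :
  (idp b n).[qnum (z - 1)] = (q ^+ n)^-1 * (idp (~~ b) n).[qnum z]
    + ((odd n == b)%:R * (q / q ^+ n)) * (idps (~~ b) 2 n).[qnum z]
    + (idps (~~ b) 1 n).[qnum z] * - q ^ (- z).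
Proof.
have E1 : qnum z = q ^ z * q^-1 + q^-1 * qnum (z - 1).
  by rewrite -{1}(subrK 1 z) qnumD1 expfzDr.
have E2 : qnum z = q ^ (- z) * q + q * qnum (z - 1).
  by rewrite -{1}(subrK 1 z) qnumD1r opprB addrC expfzDr // mulrC addrC expr1z (mulrC q).
have z0 := qz_neq0 z; move: E1 E2; rewrite -invr_expz => E1 E2.
apply: horner_idp_shift; first by rewrite -[LHS](mulKf q_neq0) E2; field; rewrite z0.
have -> : qnum (z - 1) = q * qnum z - q ^ z by rewrite E1; field.
by field.
Qed.

Lemma horner0_idp n : (idp false n.+1).[0] = 0.
Proof.
(* The second conjunct disposes of the correction term; its oddness condition excludes index 0,
   where the value is 1. *)
suff: (idp false n.+1).[0] = 0 /\ (odd n -> (idp false n).[0] = 0) by case.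
elim: n => [|n [IH1 IH2]].
  split=> //; apply: (mulfI (qnum_neq0 0)); rewrite mulr0 -hornerZ idp_rec.
  by rewrite qnum0 mulr0 scale0r subr0 !hornerE.
split=> //; apply: (mulfI (qnum_neq0 n.+1)); rewrite mulr0 -hornerZ idp_rec idps1S.
rewrite hornerD hornerM hornerX mul0r add0r hornerN hornerZ odd_eqS.
by case: (boolP (odd n)) => [/IH2->|_]; rewrite ?mulr0 ?mul0r oppr0.
Qed.

Lemma size_idp b n : size (idp b n) = n.+1.
Proof.
suff: size (idp b n) = n.+1 /\ (size (idps b 1 n) <= n)%N by case.
elim: n => [|n [IH1 IH2]]; first by rewrite idp0 size_poly1 /idps size_poly0.
rewrite idps1S IH1; split=> //; rewrite -(size_scale _ (qnum_neq0 n)) idp_rec mulrC.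
have nz : idp b n != 0 by rewrite -size_poly_gt0 IH1.
rewrite size_polyDl size_mulX // IH1 // size_polyN ltnS.
by apply: leq_trans (size_scale_leq _ _) _; apply: leq_trans IH2 _; lia.
Qed.

(** * The matrix of t and the embedding of L(mu + 1) into L(mu) (x) L(1) *)

Definition tentry (kap : F) (mu i j : nat) : F :=
  (if i == j.+1 then qnum (j%:Z + 1) else 0)
  + (if i.+1 == j then q ^ (- 1 - (mu%:Z - 2 * j%:Z)) * qnum (mu%:Z - j%:Z + 1) else 0)
  + (if i == j then kap * q ^ (- (mu%:Z - 2 * j%:Z)) else 0).

Definition tmx kap mu : 'M[F]_mu.+1 := \matrix_(i, j) tentry kap mu i j.

(** Both sides live on the three central diagonals, each giving an identity in powers of [q].
    Indices are arbitrary naturals; bounds are left to the matrix statement. *)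
Lemma tentry_intertwine1 kap mu i j :
  q ^- i * tentry kap mu.+1 i j = q^-1 * (tentry kap mu i j * q ^- j) + (i.+1 == j)%:R.
Proof.
have M0 : q ^+ mu != 0 by rewrite expf_neq0.
rewrite /tentry /qnum PoszS1 !mulr_natl !mulr2n.
case: (eqVneq i j.+1) => [->|_].
  have -> : (j.+2 == j) = false by lia.
  have -> : (j.+1 == j) = false by lia.
  have J0 : q ^+ j != 0 by rewrite expf_neq0.
  by rewrite mulr0n exprS /=; field; rewrite q_neq0 q2_sub1_neq0 J0.
case: (eqVneq i.+1 j) => [<-|_].
  have -> : (i == i.+1) = false by lia.
  have I0 : q ^+ i != 0 by rewrite expf_neq0.
  rewrite PoszS1 !opprD !opprK !expfzDr // -!invr_expz -!exprnP ?expr1z ?expr1 ?exprS mulr1n /=.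
  by field; rewrite q_neq0 q2_sub1_neq0 M0 I0.
case: (eqVneq i j) => [->|_].
  have J0 : q ^+ j != 0 by rewrite expf_neq0.
  rewrite !opprD !opprK !expfzDr // -!invr_expz -!exprnP ?expr1z ?expr1 mulr0n /=.
  by field; rewrite q_neq0 M0 J0.
by rewrite mulr0n !addr0 mul0r !mulr0.
Qed.

(** Raising [mu] and both indices by one multiplies an entry by [q], except that the subdiagonal
    gains $q^{-i}$, as $[i+1] = q^{-i} + q[i]$. *)
Lemma tentry_intertwine2 kap mu i j :
  tentry kap mu.+1 i.+1 j =
  (i == j)%:R * q ^- i + q * (if j is j'.+1 then tentry kap mu i j' else 0).
Proof.
have M0 : q ^+ mu != 0 by rewrite expf_neq0.
rewrite /tentry PoszS1 eqSS.
case: j => [|j].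
  rewrite !mulr0 add0r qnum1.
  case: (eqVneq i 0%N) => [->|_] /=; last by rewrite mul0r !addr0.
  by rewrite !addr0 expr0 invr1 mulr1.
rewrite !eqSS; have [->|ij] := eqVneq i j.+1.
  have -> : (j.+2 == j) = false by lia.
  have -> : (j.+1 == j) = false by lia.
  by rewrite PoszS1 qnumD1r -PoszS1 -invr_expz -exprnP mul1r !addr0 mulrC.
rewrite mul0r add0r; case: (eqVneq i.+1 j) => [<-|_].
  have -> : (i == i.+1) = false by lia.
  have -> : (mu%:Z + 1 - i.+2%:Z + 1) = mu%:Z - i.+1%:Z + 1 by lia.
  have -> : - 1 - (mu%:Z + 1 - 2 * i.+2%:Z) = 1 + (- 1 - (mu%:Z - 2 * i.+1%:Z)) by lia.
  by rewrite !add0r !addr0 expfzDr // expr1z -mulrA.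
case: (eqVneq i j) => _.
  have -> : - (mu%:Z + 1 - 2 * j.+1%:Z) = 1 - (mu%:Z - 2 * j%:Z) by lia.
  by rewrite !add0r expfzDr // expr1z mulrCA.
by rewrite !addr0 !add0r mulr0.
Qed.

(* Components of L(mu+1) -> L(mu) (x) L(1): F^(a) v goes to
   q^-a F^(a) v (x) w + F^(a-1) v (x) F w. *)
Definition emb1 mu : 'M[F]_(mu.+1, mu.+2) :=
  \matrix_(i, j) ((i == j :> nat)%:R * q ^- i).
Definition emb2 mu : 'M[F]_(mu.+1, mu.+2) := \matrix_(i, j) (i.+1 == j)%:R.

Lemma sum_mul_eqn n (j : nat) (G : nat -> F) :
  \sum_(k < n) G k * (k == j :> nat)%:R = if (j < n)%N then G j else 0.
Proof.
rewrite -(@big_ord1_eq _ 0 +%R G j n) [RHS]big_mkcond /=.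
by apply: eq_bigr => k _; case: eqP => _; rewrite ?mulr1 ?mulr0.
Qed.

(** On L(mu) (x) L(1), t acts as $t \otimes K^{-1} + 1 \otimes (F + \check E)$, so $\kappa$ enters
    the block matrix only through its action on L(mu). This lemma and the next are the two
    components of equivariance. *)
Lemma tmx_emb1 kap mu :
  emb1 mu *m tmx kap mu.+1 = q^-1 *: (tmx kap mu *m emb1 mu) + emb2 mu.
Proof.
apply/matrixP => i j; rewrite !mxE.
under eq_bigr do rewrite !mxE [_ * q ^- _]mulrC mulrAC (eq_sym (i : nat)).
rewrite (sum_mul_eqn mu.+2 i (fun k => q ^- i * tentry kap mu.+1 k j)) (leqW (ltn_ord i)).
under eq_bigr do rewrite !mxE [_%:R * _]mulrC mulrA.
rewrite (sum_mul_eqn mu.+1 j (fun k => tentry kap mu i k * q ^- k)) tentry_intertwine1.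
(* Column [mu.+1] lies outside the matrix for L(mu); the entry formula gives 0 there because of its
   factor $[\mu-j+1] = [0]$. *)
have [//|j_gt] := ltnP j mu.+1; congr (_ * _ + _).
have -> : j = mu.+1 :> nat by have := ltn_ord j; lia.
rewrite /tentry; have -> : (i == mu.+2 :> nat) = false by have := ltn_ord i; lia.
have -> : (i == mu.+1 :> nat) = false by have := ltn_ord i; lia.
have -> : mu%:Z - mu.+1%:Z + 1 = 0 by lia.
by rewrite qnum0 mulr0 if_same !addr0 mul0r.
Qed.

Lemma tmx_emb2 kap mu :
  emb2 mu *m tmx kap mu.+1 = emb1 mu + q *: (tmx kap mu *m emb2 mu).
Proof.
apply/matrixP => i j; rewrite !mxE.
under eq_bigr do rewrite !mxE mulrC (eq_sym i.+1).
rewrite (sum_mul_eqn mu.+2 i.+1 (fun k => tentry kap mu.+1 k j)) ltnS ltn_ord.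
rewrite tentry_intertwine2; congr (_ + _ * _).
under eq_bigr do rewrite !mxE.
case: j => [[|j] jlt] /=; first by rewrite big1 // => k _; rewrite mulr0.
under eq_bigr do rewrite eqSS.
by rewrite (sum_mul_eqn mu.+1 j (fun k => tentry kap mu i k)) -ltnS jlt.
Qed.

(** * Closed product formulas *)

Definition qfactorial n := \prod_(1 <= i < n.+1) qnum i%:Z.

Lemma qfactorialS n : qfactorial n.+1 = qfactorial n * qnum n.+1.
Proof. by rewrite /qfactorial big_nat_recr. Qed.

Lemma qfactorialSV n : (qfactorial n.+1)^-1 = (qfactorial n)^-1 / qnum n.+1.
Proof. by rewrite qfactorialS invfM. Qed.

Definition even_prod a : {poly F} :=
  \prod_(i < (2 * a).+1) ('X - (qnum (2 * (i%:Z - a%:Z)))%:P).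

(** The two new outer roots are $\pm[2a+2]$. *)
Lemma even_prodS a :
  even_prod a.+1 = ('X ^+ 2 - (qnum (2 * a).+2 ^+ 2)%:P) * even_prod a.
Proof.
rewrite /even_prod; have -> : (2 * a.+1).+1 = (2 * a).+3 by lia.
rewrite big_ord_recl big_ord_recr /=.
have -> : 2 * (0%:Z - a.+1%:Z) = - (2 * a).+2%:Z by lia.
have -> : 2 * ((bump 0 (2 * a).+1)%:Z - a.+1%:Z) = (2 * a).+2%:Z by rewrite /bump; lia.
rewrite qnumN polyCN opprK rmorphXn /=.
under eq_bigr => i _ do have -> : (bump 0 i)%:Z - a.+1%:Z = i%:Z - a%:Z by rewrite /bump; lia.
by move: (\prod_(i < _) _) => P; ring.
Qed.

(** The recursion has no correction when it leaves an odd index, so two steps from index $2a+1$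
    multiply by $(X^2-[2a+2]^2)/([2a+2][2a+3])$, in agreement with [even_prodS]. *)
Lemma idp_false_closed a :
  idp false (2 * a).+1 = (qfactorial (2 * a).+1)^-1 *: even_prod a /\
  idp false (2 * a).+2 = (qfactorial (2 * a).+2)^-1 *: ('X * even_prod a).
Proof.
have even_case c : idp false (2 * c).+1 = (qfactorial (2 * c).+1)^-1 *: even_prod c ->
    idp false (2 * c).+2 = (qfactorial (2 * c).+2)^-1 *: ('X * even_prod c).
  move=> odd_case; apply: (scalerI (qnum_neq0 (2 * c).+1)).
  rewrite idp_rec odd_eqS mul2n odd_double /= mul0r scale0r subr0 -mul2n odd_case.
  by rewrite -scalerAr scalerA (qfactorialSV (2 * c).+1) mulrCA mulfV ?mulr1 ?qnum_neq0.
suff odd_case : idp false (2 * a).+1 = (qfactorial (2 * a).+1)^-1 *: even_prod a.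
  by split=> //; apply: even_case.
elim: a => [|a IH].
  rewrite muln0; apply: (scalerI (qnum_neq0 0)); rewrite idp_rec idp0 qnum0 mulr0 scale0r subr0.
  rewrite /qfactorial /even_prod big_nat1 big_ord1 scalerA mulfV ?qnum_neq0 //=.
  by rewrite subrr mulr0 qnum0 subr0 mulr1 scale1r.
have -> : (2 * a.+1).+1 = (2 * a).+3 by lia.
have u0 := qnum_neq0 (2 * a).+1; have w0 := qnum_neq0 (2 * a).+2.
apply: (scalerI w0).
rewrite idp_rec !odd_eqS mul2n odd_double /= mul1r -mul2n idps1S (even_case _ IH) IH even_prodS.
rewrite [RHS]scalerA (qfactorialSV (2 * a).+2) (qfactorialSV (2 * a).+1).
set u := qnum (2 * a).+2 in u0 *; set w := qnum (2 * a).+3 in w0 *.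
set c := (qfactorial _)^-1; rewrite [w * _]mulrC mulfVK // mulrBl scalerBr.
congr (_ - _); first by rewrite -scalerAr mulrA -expr2.
by rewrite mul_polyC !scalerA; congr (_ *: _); field.
Qed.

(** * Laurent polynomials with integer coefficients *)

(** The subring $\mathbb Z[a]$, used for $a = q$ (numerators of Laurent polynomials) and $a =
    q^{-1}$. *)
Definition zpoly_in (a x : F) : Prop :=
  exists p : {poly int}, x = (map_poly (fun z : int => z%:~R : F) p).[a].

Lemma zpoly_inD a x y : zpoly_in a x -> zpoly_in a y -> zpoly_in a (x + y).
Proof.
move=> [p ->] [p' ->]; exists (p + p').
by rewrite (raddfD (map_poly (intmul (1 : F)))) hornerD.
Qed.

Lemma zpoly_inM a x y : zpoly_in a x -> zpoly_in a y -> zpoly_in a (x * y).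
Proof.
move=> [p ->] [p' ->]; exists (p * p').
by rewrite (rmorphM (map_poly (intmul (1 : F)))) hornerM.
Qed.

Lemma zpoly_inZ a (z : int) : zpoly_in a z%:~R.
Proof. by exists z%:P; rewrite (map_polyC (intmul (1 : F))) hornerC. Qed.

Lemma zpoly_in_gen a : zpoly_in a a.
Proof. by exists 'X; rewrite (map_polyX (intmul (1 : F))) hornerX. Qed.

Lemma zpoly_inX a n : zpoly_in a (a ^+ n).
Proof.
elim: n => [|n IHn]; first exact: (zpoly_inZ a 1).
by rewrite exprS; apply: zpoly_inM => //; exact: zpoly_in_gen.
Qed.

(** Phrased like [in_A], so that the two agree by conversion over [Qq]; [neg_laurent] mirrors
    [in_qinvZqinv] in the same way. *)
Definition laurent (x : F) : Prop :=
  exists (p : {poly int}) (k : nat),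
    x = (map_poly (fun z : int => z%:~R : F) p).[q] / q ^+ k.

Lemma laurentP x : laurent x <-> exists k, zpoly_in q (x * q ^+ k).
Proof.
split=> [[p [k ->]]|[k [p Ep]]]; first by exists k, p; rewrite divfK ?expf_neq0.
by exists p, k; rewrite -Ep mulfK ?expf_neq0.
Qed.

Lemma laurentZ (z : int) : laurent z%:~R.
Proof. by apply/laurentP; exists 0%N; rewrite mulr1; apply: zpoly_inZ. Qed.

Lemma laurent0 : laurent 0. Proof. exact: (laurentZ 0). Qed.
Lemma laurent1 : laurent 1. Proof. exact: (laurentZ 1). Qed.

Lemma laurentD x y : laurent x -> laurent y -> laurent (x + y).
Proof.
move=> /laurentP[k xk] /laurentP[l yl]; apply/laurentP; exists (k + l)%N.
rewrite mulrDl {1}exprD mulrA (addnC k l) exprD mulrA.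
by apply: zpoly_inD; apply: zpoly_inM => //; apply: zpoly_inX.
Qed.

Lemma laurentM x y : laurent x -> laurent y -> laurent (x * y).
Proof.
move=> /laurentP[k xk] /laurentP[l yl]; apply/laurentP; exists (k + l)%N.
by rewrite exprD mulrACA; apply: zpoly_inM.
Qed.

Lemma laurentN x : laurent x -> laurent (- x).
Proof. by rewrite -mulN1r; apply: laurentM; apply: (laurentZ (-1)). Qed.

Lemma laurentX n : laurent (q ^+ n).
Proof. by apply/laurentP; exists 0%N; rewrite mulr1; apply: zpoly_inX. Qed.

Lemma laurentXV n : laurent (q ^- n).
Proof. by apply/laurentP; exists n; rewrite mulVf ?expf_neq0 //; apply: (zpoly_inZ q 1). Qed.

Lemma laurentXz (z : int) : laurent (q ^ z).
Proof. by case: z => n; [apply: laurentX | apply: laurentXV]. Qed.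

Lemma laurent_bool (b : bool) : laurent b%:R.
Proof. by case: b; [apply: laurent1 | apply: laurent0]. Qed.

Lemma laurent_sum (I : Type) (r : seq I) (G : I -> F) :
  (forall i, laurent (G i)) -> laurent (\sum_(i <- r) G i).
Proof.
by move=> LG; apply: big_ind => //; [apply: laurent0 | apply: laurentD].
Qed.

Definition neg_laurent (x : F) : Prop :=
  exists p : {poly int},
    x = q^-1 * (map_poly (fun z : int => z%:~R : F) p).[q^-1].

Lemma neg_laurentP x : neg_laurent x <-> exists2 y, zpoly_in q^-1 y & x = q^-1 * y.
Proof.
split=> [[p ->]|[y [p ->] ->]]; last by exists p.
by exists (map_poly (fun z : int => z%:~R : F) p).[q^-1] => //; exists p.
Qed.

Lemma neg_laurentD x y : neg_laurent x -> neg_laurent y -> neg_laurent (x + y).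
Proof.
move=> /neg_laurentP[x' Lx ->] /neg_laurentP[y' Ly ->]; apply/neg_laurentP.
by exists (x' + y'); rewrite ?mulrDr //; apply: zpoly_inD.
Qed.

Lemma neg_laurent0 : neg_laurent 0.
Proof. by apply/neg_laurentP; exists 0; [apply: (zpoly_inZ _ 0) | rewrite mulr0]. Qed.

Lemma zpoly_in_neg_laurent x : neg_laurent x -> zpoly_in q^-1 x.
Proof.
by move=> /neg_laurentP[y Ly ->]; apply: zpoly_inM => //; apply: zpoly_in_gen.
Qed.

Lemma neg_laurentMr x y : neg_laurent x -> zpoly_in q^-1 y -> neg_laurent (x * y).
Proof.
move=> /neg_laurentP[x' Lx ->] Ly; apply/neg_laurentP.
by exists (x' * y); rewrite ?mulrA //; apply: zpoly_inM.
Qed.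

(** A large power of $q^{-1}$ outweighs the highest power of $q$ in [x]. *)
Lemma laurent_eventually_neg x : laurent x ->
  exists M, forall m, (M <= m)%N -> neg_laurent (q ^- m * x).
Proof.
move=> [p [k ->]]; set y := _.[q].
suff [M HM] : exists M, forall m, (M <= m)%N -> zpoly_in q^-1 (q ^- m * y).
  exists M.+1 => -[//|m] Mm; apply/neg_laurentP; exists (q^-1 ^+ k * (q ^- m * y)).
    by apply: zpoly_inM; [apply: zpoly_inX | apply: HM].
  have [k0 m0] : q ^+ k != 0 /\ q ^+ m != 0 by rewrite !expf_neq0.
  by rewrite exprVn exprS; field; rewrite q_neq0 k0 m0.
rewrite {}/y; elim/poly_ind: p => [|p c [M HM]].
  exists 0%N => m _; rewrite (raddf0 (map_poly (intmul (1 : F)))) horner0 mulr0.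
  exact: (zpoly_inZ _ 0).
exists M.+1 => -[//|m] Mm; rewrite (raddfD (map_poly (intmul (1 : F)))) /=.
rewrite (rmorphM (map_poly (intmul (1 : F)))) /= (map_polyX (intmul (1 : F))).
rewrite (map_polyC (intmul (1 : F))) hornerMXaddC mulrDr; apply: zpoly_inD.
  have m0 : q ^+ m != 0 by rewrite expf_neq0.
  have e Y : q ^- m.+1 * (Y * q) = q ^- m * Y by rewrite exprS; field; rewrite q_neq0 m0.
  by rewrite e; apply: HM.
by rewrite -exprVn; apply: zpoly_inM; [apply: zpoly_inX | apply: zpoly_inZ].
Qed.

(** * Integrality and coefficients of the action *)

Lemma laurent_idps b j (x : F) :
  (forall n, laurent (idp b n).[x]) -> forall n, laurent (idps b j n).[x].
Proof. by move=> L n; rewrite /idps; case: ifP => _ //; rewrite horner0; apply: laurent0. Qed.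

(** The shift formulas lead from $\pm[k]$ to $\pm[k+1]$ with Laurent coefficients and exchange the
    families; the start is $[0] = 0$, where [idp false n] vanishes for $n > 0$. *)
Lemma laurent_idp_qnum k n :
  laurent (idp (odd k) n).[qnum k] /\ laurent (idp (odd k) n).[qnum (- k%:Z)].
Proof.
elim: k n => [|k IHk] n.
  rewrite oppr0 qnum0; suff L : laurent (idp false n).[0] by [].
  case: n => [|n]; last by rewrite horner0_idp; apply: laurent0.
  by rewrite idp0 hornerC; apply: laurent1.
have shift (z : int) (x : F) : (forall n, laurent (idp (odd k) n).[qnum z]) -> laurent x ->
    laurent ((q ^+ n)^-1 * (idp (odd k) n).[qnum z]
      + ((odd n == odd k.+1)%:R * (q / q ^+ n)) * (idps (odd k) 2 n).[qnum z]
      + (idps (odd k) 1 n).[qnum z] * x).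
  move=> L Lx; have Ls := laurent_idps _ L.
  apply: laurentD; last exact: laurentM.
  apply: laurentD; apply: laurentM => //; first exact: laurentXV.
  by apply/laurentM/laurentM/laurentXV/(laurentX 1)/laurent_bool.
have E : ~~ odd k.+1 = odd k by rewrite /= negbK.
split.
  rewrite PoszS1 horner_idp_up E; apply: shift (laurentXz _) => m.
  by have [] := IHk m.
rewrite PoszS1 opprD horner_idp_down E; apply: shift (laurentN (laurentXz _)) => m.
by have [] := IHk m.
Qed.

(** This is what the form $[2\ell-1]$ of $\kappa$ provides: an odd integer is $\pm k$ for an odd
    natural [k]. *)
Lemma laurent_idp_odd (z : int) n : laurent (idp true n).[qnum (2 * z - 1)].
Proof.
have [k [k_odd [->|->]]] : exists k : nat, odd k /\ (2 * z - 1 = k \/ 2 * z - 1 = - k%:Z).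
- by exists `|(2 * z - 1)%R|%N; split; lia.
- by have [] := laurent_idp_qnum k n; rewrite k_odd.
- by have [] := laurent_idp_qnum k n; rewrite k_odd.
Qed.

Lemma mul_emb1_row0 mu m (M : 'M[F]_(mu.+2, m)) j : (emb1 mu *m M) 0 j = M 0 j.
Proof.
rewrite mxE (bigD1 ord0) //= big1 ?addr0 => [|k k0].
  by rewrite mxE eqxx expr0 invr1 !mul1r.
rewrite mxE eq_sym; case: eqP => [k_eq|_]; last by rewrite !mul0r.
by case/eqP: k0; apply: val_inj.
Qed.

Lemma mul_emb2_row mu m (M : 'M[F]_(mu.+2, m)) i j :
  (emb2 mu *m M) i j = M (lift ord0 i) j.
Proof.
rewrite mxE (bigD1 (lift ord0 i)) //= big1 ?addr0 => [|k k0].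
  by rewrite mxE eqxx mul1r.
rewrite mxE; case: eqP => [k_eq|_]; last by rewrite mul0r.
by case/eqP: k0; apply: val_inj.
Qed.

Lemma mul_emb1_col0 mu m (M : 'M[F]_(m, mu.+1)) i : (M *m emb1 mu) i 0 = M i 0.
Proof.
rewrite mxE (bigD1 ord0) //= big1 ?addr0 => [|k k0].
  by rewrite mxE eqxx expr0 invr1 !mulr1.
rewrite mxE; case: eqP => [k_eq|_]; last by rewrite mul0r mulr0.
by case/eqP: k0; apply: val_inj.
Qed.

Lemma mul_emb2_col0 mu m (M : 'M[F]_(m, mu.+1)) i : (M *m emb2 mu) i 0 = 0.
Proof. by rewrite mxE big1 // => k _; rewrite mxE mulr0. Qed.

Definition laurent_mx m n (M : 'M[F]_(m, n)) := forall i j, laurent (M i j).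

Lemma laurent_mxD m n (M N : 'M[F]_(m, n)) :
  laurent_mx M -> laurent_mx N -> laurent_mx (M + N).
Proof. by move=> LM LN i j; rewrite mxE; apply: laurentD. Qed.

Lemma laurent_mxZ m n a (M : 'M[F]_(m, n)) :
  laurent a -> laurent_mx M -> laurent_mx (a *: M).
Proof. by move=> La LM i j; rewrite mxE; apply: laurentM. Qed.

Lemma laurent_mxM m n p (M : 'M[F]_(m, n)) (N : 'M[F]_(n, p)) :
  laurent_mx M -> laurent_mx N -> laurent_mx (M *m N).
Proof. by move=> LM LN i j; rewrite mxE; apply: laurent_sum => k; apply: laurentM. Qed.

Lemma laurent_emb1 mu : laurent_mx (emb1 mu).
Proof. by move=> i j; rewrite mxE; apply: laurentM (laurentXV _); apply: laurent_bool. Qed.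

Lemma laurent_emb2 mu : laurent_mx (emb2 mu).
Proof. by move=> i j; rewrite mxE; apply: laurent_bool. Qed.

Lemma laurent_mx_idps m (T : 'M[F]_m.+1) b j :
  (forall n, laurent_mx (horner_mx T (idp b n))) ->
  forall n, laurent_mx (horner_mx T (idps b j n)).
Proof.
move=> L n; rewrite /idps; case: ifP => _ //; rewrite rmorph0 => i k.
by rewrite mxE; apply: laurent0.
Qed.

Definition idpmx kap mu b n := horner_mx (tmx kap mu) (idp b n).
Definition idpsmx kap mu b j n := horner_mx (tmx kap mu) (idps b j n).

Lemma idpmx_emb kap mu b n :
  emb1 mu *m idpmx kap mu.+1 b n =
    (q ^+ n)^-1 *: (idpmx kap mu (~~ b) n *m emb1 mu)
    + ((odd n == b)%:R * (q / q ^+ n)) *: (idpsmx kap mu (~~ b) 2 n *m emb1 mu)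
    + idpsmx kap mu (~~ b) 1 n *m emb2 mu
  /\
  emb2 mu *m idpmx kap mu.+1 b n =
    idpsmx kap mu (~~ b) 1 n *m emb1 mu
    + (q ^+ n *: (idpmx kap mu (~~ b) n *m emb2 mu)
       + ((odd n == b)%:R * (q^-1 * q ^+ n)) *: (idpsmx kap mu (~~ b) 2 n *m emb2 mu)).
Proof. exact: idp_intertwine (tmx_emb1 kap mu) (tmx_emb2 kap mu) b n. Qed.

Lemma idpmx0 kap mu b : idpmx kap mu b 0 = 1%:M.
Proof. by rewrite /idpmx idp0; apply: rmorph1. Qed.

Lemma idpsmx1S kap mu b n : idpsmx kap mu b 1 n.+1 = idpmx kap mu b n.
Proof. by rewrite /idpsmx idps1S. Qed.

Lemma idpsmx_small kap mu b j n : (n < j)%N -> idpsmx kap mu b j n = 0.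
Proof. by move=> nj; rewrite /idpsmx /idps leqNgt nj rmorph0. Qed.

(** Row 0 of a matrix on L(mu + 1) is row 0 of its product with [emb1], and the other rows form its
    product with [emb2]; both products are expressed through L(mu). On L(0), t is the scalar
    [kap]. *)
Lemma laurent_idpmx kap : (forall n, laurent (idp true n).[kap]) ->
  forall mu n, laurent_mx (idpmx kap mu (~~ odd mu) n).
Proof.
move=> Lkap; elim=> [|mu IH] n.
  have -> : idpmx kap 0 (~~ odd 0) n = ((idp true n).[kap])%:M.
    rewrite -horner_mx_scalar /idpmx; congr (horner_mx _ _).
    apply/matrixP => i j; rewrite !mxE !ord1 /tentry /= subrr oppr0 expr0z.
    by rewrite !add0r mulr1 mulr1n.
  by move=> i j; rewrite mxE !ord1 mulr1n.
have Ls j k : laurent_mx (idpsmx kap mu (~~ odd mu) j k) by exact: laurent_mx_idps.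
have [E1 E2] := idpmx_emb kap mu (~~ odd mu.+1) n.
rewrite oddS negbK in E1 E2 *.
have L1 : laurent_mx (emb1 mu *m idpmx kap mu.+1 (odd mu) n).
  rewrite E1; apply: laurent_mxD; last by apply: laurent_mxM; [apply: Ls | apply: laurent_emb2].
  apply: laurent_mxD; apply: laurent_mxZ.
  - exact: laurentXV.
  - by apply: laurent_mxM; [apply: IH | apply: laurent_emb1].
  - by apply: laurentM (laurent_bool _) (laurentM (laurentX 1) (laurentXV _)).
  - by apply: laurent_mxM; [apply: Ls | apply: laurent_emb1].
have L2 : laurent_mx (emb2 mu *m idpmx kap mu.+1 (odd mu) n).
  rewrite E2; apply: laurent_mxD; first by apply: laurent_mxM; [apply: Ls | apply: laurent_emb1].
  apply: laurent_mxD; apply: laurent_mxZ.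
  - exact: laurentX.
  - by apply: laurent_mxM; [apply: IH | apply: laurent_emb2].
  - by apply: laurentM (laurent_bool _) (laurentM (laurentXV 1) (laurentX _)).
  - by apply: laurent_mxM; [apply: Ls | apply: laurent_emb2].
move=> i j; case: (unliftP ord0 i) => [i' ->|->].
  by rewrite -mul_emb2_row; apply: L2.
by rewrite -mul_emb1_row0; apply: L1.
Qed.

Lemma addmxE m n (A B : 'M[F]_(m, n)) i j : (A + B) i j = A i j + B i j.
Proof. exact: mxE. Qed.

Lemma scalemxE m n a (A : 'M[F]_(m, n)) i j : (a *: A) i j = a * A i j.
Proof. exact: mxE. Qed.

(** The highest weight vector goes to $v \otimes w$, so in column 0 only the [emb1] term
    survives. *)
Lemma idpmx_lift kap mu n (r : 'I_mu.+1) :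
  idpmx kap mu.+1 (~~ odd mu.+1) n (lift ord0 r) 0 = idpsmx kap mu (~~ odd mu) 1 n r 0.
Proof.
rewrite -mul_emb2_row (idpmx_emb kap mu _ n).2 oddS !negbK.
by rewrite !addmxE !scalemxE mul_emb1_col0 !mul_emb2_col0 !mulr0 !addr0.
Qed.

Lemma idpmx_corner kap mu n :
  idpmx kap mu.+1 (~~ odd mu.+1) n 0 0 = q ^- n * idpmx kap mu (~~ odd mu) n 0 0
  + (odd n == odd mu)%:R * (q / q ^+ n) * idpsmx kap mu (~~ odd mu) 2 n 0 0.
Proof.
rewrite -mul_emb1_row0 (idpmx_emb kap mu _ n).1 oddS !negbK.
by rewrite !addmxE !scalemxE !mul_emb1_col0 mul_emb2_col0 addr0.
Qed.

(** Each use of [idpmx_lift] lowers [mu], [n] and the row by one, until row 0 is reached or [n] is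
    exhausted. *)
Lemma idpmx_coef kap r mu n (lt_r : (r < mu.+1)%N) :
  idpmx kap mu (~~ odd mu) n (Ordinal lt_r) 0 =
  if (r <= n)%N then idpmx kap (mu - r) (~~ odd (mu - r)) (n - r) 0 0 else 0.
Proof.
elim: r mu n lt_r => [|r IHr] mu n lt_r.
  have -> : Ordinal lt_r = 0 by apply: val_inj.
  by rewrite leq0n !subn0.
case: mu lt_r => [//|mu] lt_r.
have -> : Ordinal lt_r = lift ord0 (Ordinal (lt_r : (r < mu.+1)%N)) by apply: val_inj.
rewrite idpmx_lift subSS; case: n => [|n]; first by rewrite idpsmx_small // mxE.
by rewrite idpsmx1S IHr ltnS subSS.
Qed.

Lemma idpmx_corner0 kap mu b : idpmx kap mu b 0 0 0 = 1.
Proof. by rewrite idpmx0 mxE. Qed.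

(** By [idpmx_corner] these coefficients satisfy $a_{\mu+1} = q^{-n}a_\mu + \varepsilon_\mu$, with
    $\varepsilon_\mu$ governed by index $n-2$. Once $\varepsilon_\mu \in q^{-1}\mathbb Z[q^{-1}]$,
    iteration damps the initial Laurent polynomial. *)
Lemma idpmx_corner_neg kap : (forall n, laurent (idp true n).[kap]) ->
  forall n, (0 < n)%N -> exists M, forall mu, (M <= mu)%N ->
    neg_laurent (idpmx kap mu (~~ odd mu) n 0 0).
Proof.
move=> Lkap; elim/ltn_ind => n IHn n0.
have [M0 HM0] : exists M, forall mu, (M <= mu)%N ->
    neg_laurent ((q / q ^+ n) * idpsmx kap mu (~~ odd mu) 2 n 0 0).
  case: n n0 IHn => [//|[|n]] _ IHn.
    by exists 0%N => mu _; rewrite idpsmx_small // mxE mulr0; apply: neg_laurent0.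
  (* The lower index, now called [n], may be 0 with corner 1, so only $\mathbb Z[q^{-1}]$ is asked;
     the prefactor $q^{-1}q^{-n}$ supplies the missing $q^{-1}$. *)
  have [M HM] : exists M, forall mu, (M <= mu)%N ->
      zpoly_in q^-1 (idpmx kap mu (~~ odd mu) n 0 0).
    case: n IHn => [|n] IHn.
      by exists 0%N => mu _; rewrite idpmx_corner0; apply: (zpoly_inZ _ 1).
    have [//|//|M HM] := IHn n.+1; exists M => mu /HM; exact: zpoly_in_neg_laurent.
  exists M => mu /HM L; apply: neg_laurentMr; last first.
    by rewrite /idpsmx idps2S idps1S.
  apply/neg_laurentP; exists (q^-1 ^+ n); first exact: zpoly_inX.
  have qn0 : q ^+ n != 0 by rewrite expf_neq0.
  by rewrite !exprS exprVn; field; rewrite q_neq0 qn0.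
have L0 : laurent (idpmx kap M0 (~~ odd M0) n 0 0) by apply: laurent_idpmx.
have [M1 HM1] := laurent_eventually_neg L0.
have step k : exists2 e, neg_laurent e &
    idpmx kap (M0 + k) (~~ odd (M0 + k)) n 0 0 =
    q ^- (n * k) * idpmx kap M0 (~~ odd M0) n 0 0 + e.
  elim: k => [|k [e Le Ek]].
    by exists 0; [apply: neg_laurent0 | rewrite addn0 muln0 expr0 invr1 mul1r addr0].
  rewrite addnS idpmx_corner Ek.
  exists (e * q^-1 ^+ n + (odd n == odd (M0 + k))%:R *
           (q / q ^+ n * idpsmx kap (M0 + k) (~~ odd (M0 + k)) 2 n 0 0)).
    apply: neg_laurentD; first by apply: neg_laurentMr => //; apply: zpoly_inX.
    rewrite mulrC; apply: neg_laurentMr; first by apply: HM0; apply: leq_addr.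
    by case: eqP => _; [apply: (zpoly_inZ _ 1) | apply: (zpoly_inZ _ 0)].
  by rewrite mulrDr mulnS exprD invfM !mulrA exprVn (mulrC e) addrA.
(* The exponent $n(\mu-M_0)$ is at least [M1] since $n > 0$. *)
exists (M0 + M1)%N => mu Mmu; have -> : mu = (M0 + (mu - M0))%N by lia.
have [e Le ->] := step (mu - M0)%N; apply: neg_laurentD => //; apply: HM1.
by apply: leq_trans (leq_pmull _ n0); lia.
Qed.

(** * Triangularity and expansion in divided powers *)

Lemma size_sub_idp b N (x : {poly F}) : (size x <= N.+1)%N ->
  exists c, (size (x - c *: idp b N)%R <= N)%N.
Proof.
move=> szx; have lN : (idp b N)`_N != 0.
  by have := lead_coef_eq0 (idp b N); rewrite lead_coefE size_idp -size_poly_eq0 size_idp => ->.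
exists (x`_N / (idp b N)`_N); apply/leq_sizeP => j; rewrite leq_eqVlt => /predU1P[<-|Nj].
  by rewrite coefB coefZ divfK // subrr.
rewrite coefB coefZ [(idp b N)`_j]nth_default ?size_idp // mulr0 subr0.
exact: nth_default (leq_trans szx Nj).
Qed.

(** Divided powers of degree below [r] all fall in the zero case of [idpmx_coef]. *)
Lemma horner_tmx_triangular kap mu (x : {poly F}) (r : 'I_mu.+1) :
  (size x <= r)%N -> horner_mx (tmx kap mu) x r 0 = 0.
Proof.
move: {2}(size x) (leqnn (size x)) => N; elim: N x => [|N IHN] x szx szr.
  by move: szx; rewrite leqn0 size_poly_eq0 => /eqP ->; rewrite rmorph0 mxE.
have [szN|szN] := leqP (size x) N; first exact: IHN.
have [c szc] := size_sub_idp (~~ odd mu) szx.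
have Nr : (N < r)%N by apply: leq_trans szN szr.
rewrite -(subrK (c *: idp (~~ odd mu) N) x) rmorphD /= mxE IHN //; last first.
  exact: leq_trans szc (ltnW Nr).
have := idpmx_coef kap N (ltn_ord r).
have -> : Ordinal (ltn_ord r) = r by apply: val_inj.
by rewrite leqNgt Nr /idpmx add0r horner_mxZ mxE => ->; rewrite mulr0.
Qed.

Lemma idp_lin_indep b N (c : nat -> F) :
  \sum_(i < N) c i *: idp b i = 0 -> forall i, (i < N)%N -> c i = 0.
Proof.
elim: N => [//|N IHN]; rewrite big_ord_recr /= => sum0.
have sz : (size (\sum_(i < N) c i *: idp b i)%R <= N)%N.
  apply: (leq_trans (size_sum _ _ _)); apply/bigmax_leqP => i _.
  by apply: leq_trans (size_scale_leq _ _) _; rewrite size_idp.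
have cN : c N = 0.
  apply/eqP; apply: contraTT isT => cN; move: sz.
  move/eqP: sum0; rewrite addr_eq0 => /eqP ->.
  by rewrite size_polyN size_scale // size_idp ltnn.
move=> i; rewrite ltnS leq_eqVlt => /predU1P[->//|]; apply: IHN.
by move: sum0; rewrite cN scale0r addr0.
Qed.

(** The top coefficient [c] can be read off: on L(2N + 1) it is the coefficient of $F^{(N)}v$, which
    lower degrees do not reach and which is 1 for [idp false N]. So [c] is Laurent, and the
    remainder is again integral. *)
Lemma idp_laurent_span kap (x : {poly F}) :
  (forall n, laurent (idp true n).[kap]) ->
  (forall mu r, odd mu -> laurent (horner_mx (tmx kap mu) x r 0)) ->
  exists (N : nat) (c : nat -> F), (forall i, laurent (c i)) /\
    x = \sum_(i < N) c i *: idp false i.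
Proof.
move=> Lkap; move: {2}(size x) (leqnn (size x)) => N szx Lx; exists N.
elim: N x szx Lx => [|N IHN] x szx Lx.
  exists (fun=> 0); split=> [_|]; first exact: laurent0.
  by move: szx; rewrite leqn0 size_poly_eq0 big_ord0 => /eqP.
have [c szc] := size_sub_idp false szx.
have odd_mu : odd (2 * N).+1 by rewrite /= mul2n odd_double.
have lt_N : (N < (2 * N).+2)%N by lia.
have Ec : horner_mx (tmx kap (2 * N).+1) x (Ordinal lt_N) 0 = c.
  rewrite -(subrK (c *: idp false N) x) rmorphD /= mxE horner_tmx_triangular // add0r.
  rewrite horner_mxZ mxE; have := idpmx_coef kap N lt_N.
  by rewrite odd_mu leqnn subnn idpmx_corner0 /idpmx => ->; rewrite mulr1.
have Lc : laurent c by rewrite -Ec; apply: Lx.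
have [|d [Ld xE]] := IHN _ szc.
  move=> mu r mu_odd; rewrite rmorphB /= horner_mxZ !mxE.
  apply: laurentD; first exact: Lx.
  apply/laurentN/laurentM => //; rewrite -/(idpmx _ _ _ _).
  have -> : false = ~~ odd mu by rewrite mu_odd.
  exact: laurent_idpmx.
exists (fun i => if i == N then c else d i); split=> [i|]; first by case: eqP.
rewrite big_ord_recr /= eqxx -[LHS](subrK (c *: idp false N)) xE; congr (_ + _).
by apply: eq_bigr => i _; rewrite ltn_eqF.
Qed.

End QuantumIntegers.

(** * The field Q(q) and its bar involution *)

Lemma qq_neq0 : qq != 0.
Proof. by rewrite tofrac_eq0 polyX_eq0. Qed.

Lemma polyXn_neq1 (R : nzRingType) n : (0 < n)%N -> 'X^n != 1 :> {poly R}.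
Proof.
move=> n0; apply/eqP => /(congr1 (fun p : {poly R} => size p)).
by rewrite size_polyXn size_poly1 => -[n_eq0]; rewrite n_eq0 in n0.
Qed.

Lemma qq_nonroot n : (0 < n)%N -> qq ^+ n != 1.
Proof. by move=> n0; rewrite -tofracXn -tofrac1 tofrac_eq polyXn_neq1. Qed.

Lemma frac_repr (R : idomainType) (x : {fraction R}) :
  x = tofrac \n_(repr x) / tofrac \d_(repr x).
Proof.
have d0 : tofrac \d_(repr x) != 0 by rewrite tofrac_eq0 denom_ratioP.
apply: (canRL (mulfK d0)); rewrite -{1}[x]reprK.
unlock tofrac; rewrite -[LHS]FracField.pi_mul; apply/eqmodP => /=.
rewrite FracField.equivfE /FracField.mulf !numden_Ratio ?mulr1 ?oner_neq0 ?denom_ratioP //.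
by rewrite mulrC.
Qed.

(** The coefficient map of [ev_qinv], written as a composite so that it is recognised as a ring
    morphism. *)
Local Notation ratQ := (@tofrac {poly rat} \o @polyC rat).

Lemma ev_qinvD p p' : ev_qinv (p + p') = ev_qinv p + ev_qinv p'.
Proof. by rewrite /ev_qinv (raddfD (map_poly ratQ)) hornerD. Qed.

Lemma ev_qinvM p p' : ev_qinv (p * p') = ev_qinv p * ev_qinv p'.
Proof. by rewrite /ev_qinv (rmorphM (map_poly ratQ)) hornerM. Qed.

Lemma ev_qinv1 : ev_qinv 1 = 1.
Proof. by rewrite /ev_qinv (rmorph1 (map_poly ratQ)) hornerC. Qed.

Lemma ev_qinvX : ev_qinv 'X = qq^-1.
Proof. by rewrite /ev_qinv (map_polyX ratQ) hornerX. Qed.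

(* [q^n p(1/q)] is the image of the reversed polynomial. *)
Lemma ev_qinv_eq0 p : ev_qinv p = 0 -> p = 0.
Proof.
move=> p0; pose n := size p.
pose P := \sum_(i < n) p`_i *: 'X^(n - i) : {poly rat}.
have PE : tofrac P = qq ^+ n * ev_qinv p.
  rewrite /ev_qinv horner_coef mulr_sumr rmorph_sum.
  rewrite (size_map_poly ratQ); apply: eq_bigr => i _.
  rewrite (coef_map ratQ) /= -mul_polyC rmorphM rmorphXn /=.
  rewrite mulrCA; congr (_ * _).
  by rewrite -/qq exprVn expfB.
have P0 : P = 0 by apply/eqP; rewrite -tofrac_eq0 PE p0 mulr0.
apply/polyP => j; rewrite coef0; have [nj|jn] := leqP n j; first by rewrite nth_default.
move: (congr1 (fun Q : {poly rat} => Q`_(n - j)) P0); rewrite coef0 coef_sum.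
rewrite (bigD1 (Ordinal jn)) //= coefZ coefXn eqxx mulr1 big1 ?addr0 // => i ij.
rewrite coefZ coefXn; case: eqP => [E|_]; last by rewrite mulr0.
by case/eqP: ij; apply: val_inj => /=; have := ltn_ord i; lia.
Qed.

(** Independence of the representative chosen by [repr]: [ev_qinv] preserves cross-product
    identities, and by [ev_qinv_eq0] it keeps denominators nonzero. *)
Lemma barQ_frac p d : d != 0 -> barQ (tofrac p / tofrac d) = ev_qinv p / ev_qinv d.
Proof.
move=> d0; rewrite /barQ; set x := tofrac p / tofrac d.
have r0 : \d_(repr x) != 0 by exact: denom_ratioP.
have ev0 e : e != 0 -> ev_qinv e != 0 by apply: contraNneq => /ev_qinv_eq0 ->.
apply/eqP; rewrite eqr_div ?ev0 // -!ev_qinvM; apply/eqP; congr ev_qinv.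
apply/eqP; rewrite -tofrac_eq !tofracM -eqr_div ?tofrac_eq0 //.
by rewrite -frac_repr.
Qed.

Lemma barQ_ind (P : Qq -> Prop) :
  (forall p d, d != 0 -> P (tofrac p / tofrac d)) -> forall x, P x.
Proof. by move=> HP x; rewrite [x]frac_repr; apply: HP; apply: denom_ratioP. Qed.

Lemma barQM x y : barQ (x * y) = barQ x * barQ y.
Proof.
elim/barQ_ind: x => p d d0; elim/barQ_ind: y => p' d' d'0.
by rewrite mulf_div -!tofracM !barQ_frac ?mulf_neq0 // !ev_qinvM mulf_div.
Qed.

Lemma barQD x y : barQ (x + y) = barQ x + barQ y.
Proof.
have ev0 e : e != 0 -> ev_qinv e != 0 by apply: contraNneq => /ev_qinv_eq0 ->.
elim/barQ_ind: x => p d d0; elim/barQ_ind: y => p' d' d'0.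
rewrite addf_div ?tofrac_eq0 // -!tofracM -tofracD !barQ_frac ?mulf_neq0 //.
by rewrite ev_qinvD !ev_qinvM addf_div ?ev0.
Qed.

Lemma barQ1 : barQ 1 = 1.
Proof.
have := @barQ_frac 1 1 (oner_neq0 _).
by rewrite tofrac1 ev_qinv1 divr1.
Qed.

Lemma barQ_qq : barQ qq = qq^-1.
Proof.
have := @barQ_frac 'X 1 (oner_neq0 _).
by rewrite tofrac1 ev_qinv1 ev_qinvX !divr1.
Qed.

Fact barQ_is_zmod_morphism : zmod_morphism barQ.
Proof. by move=> x y; apply: (addIr (barQ y)); rewrite -barQD !subrK. Qed.

Fact barQ_is_monoid_morphism : monoid_morphism barQ.
Proof. by split; [apply: barQ1 | move=> x y; apply: barQM]. Qed.

HB.instance Definition _ := GRing.isZmodMorphism.Build Qq Qq barQ barQ_is_zmod_morphism.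
HB.instance Definition _ := GRing.isMonoidMorphism.Build Qq Qq barQ barQ_is_monoid_morphism.

(** Bar negates both $q^n-q^{-n}$ and $q-q^{-1}$. *)
Lemma barQ_qnum n : barQ (qnum qq n) = qnum qq n.
Proof.
have barX (z : int) : barQ (qq ^ z) = qq ^ (- z).
  have -> : barQ (qq ^ z) = barQ qq ^ z by exact: fmorphXz.
  by rewrite barQ_qq exprz_inv.
have barV x : barQ x^-1 = (barQ x)^-1 by exact: fmorphV.
have barB x y : barQ (x - y) = barQ x - barQ y by exact: rmorphB.
rewrite /qnum barQM barV !barB barV !barX barQ_qq opprK invrK.
by rewrite -[X in X / _]opprB -[X in _ / X]opprB invrN mulrNN.
Qed.

(** The coefficients of the recursion are bar-invariant. *)
Lemma psi_idp b n : psi_poly (idp qq b n) = idp qq b n.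
Proof.
suff: psi_poly (idp qq b n) = idp qq b n /\ psi_poly (idps qq b 1 n) = idps qq b 1 n by case.
elim: n => [|n [IH1 IH2]].
  by rewrite idp0 /idps; split; [apply: rmorph1 | apply: rmorph0].
have psiZ a p : psi_poly (a *: p) = barQ a *: psi_poly p by exact: map_polyZ.
have psiM p p' : psi_poly (p * p') = psi_poly p * psi_poly p' by exact: rmorphM.
have psiB p p' : psi_poly (p - p') = psi_poly p - psi_poly p' by exact: rmorphB.
have psiX : psi_poly 'X = 'X by exact: map_polyX.
rewrite idps1S; split=> //.
apply: (scalerI (qnum_neq0 qq_neq0 qq_nonroot n)).
rewrite -{1}barQ_qnum -psiZ (idp_rec qq_neq0 qq_nonroot) psiB psiM psiX IH1 psiZ IH2 barQM barQ_qnum.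
by case: (odd n == b); rewrite ?barQ1 // (rmorph0 barQ).
Qed.

(** * The divided powers on the modules L(mu) *)

Lemma tdot_idp n : tdot n = idp qq false n.
Proof.
have := odd_double_half n; rewrite /tdot -mul2n; move: (n./2) => a nE.
case: eqP => [->|n0]; first by rewrite idp0.
case: (odd n) nE => [] nE; rewrite -nE in n0 *; rewrite ?add1n ?add0n in n0 *.
  by rewrite (idp_false_closed qq_neq0 qq_nonroot a).1.
(* A nonzero even index is $2(a+1)$; the product in [tdot] then has the roots $[2j]$, $-a \le j \le
   a$, of [even_prod qq a]. *)
case: a {nE} n0 => [/(_ (muln0 2))[]|a _].
have -> : (2 * a.+1).-1 = (2 * a).+1 by lia.
have -> : (2 * a.+1)%N = (2 * a).+2 by lia.
rewrite (idp_false_closed qq_neq0 qq_nonroot a).2.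
suff -> : \prod_(i < (2 * a).+1) ('X - (qint (2 * (i%:Z - a.+1%:Z + 1)))%:P) = even_prod qq a.
  by [].
by apply: eq_bigr => i _; have -> : i%:Z - a.+1%:Z + 1 = i%:Z - a%:Z by lia.
Qed.

Lemma tmat_tmx l mu : tmat l mu = tmx qq (kappa l) mu.
Proof. by apply/matrixP => i j; rewrite !mxE. Qed.

Lemma laurent_kappa l n : laurent qq (idp qq true n).[kappa l].
Proof. exact: laurent_idp_odd qq_neq0 qq_nonroot l n. Qed.

Lemma act_vplus l mu x r : act l mu x (vplus mu) r 0 = horner_mx (tmx qq (kappa l) mu) x r 0.
Proof. by rewrite /act /vplus -colE mxE tmat_tmx. Qed.

Lemma in_LA_vplus mu : in_LA (vplus mu).
Proof. by move=> i; rewrite mxE; apply: (laurent_bool qq_neq0). Qed.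

Lemma tdot_in_AUodd l n : in_AUodd l (tdot n).
Proof.
move=> mu mu_odd v Lv i; rewrite /act mxE tmat_tmx tdot_idp.
apply: (laurent_sum qq_neq0) => k; apply: (laurentM qq_neq0); last exact: Lv.
have -> : false = ~~ odd mu by rewrite mu_odd.
exact: (laurent_idpmx qq_neq0 qq_nonroot (laurent_kappa l)).
Qed.

(** One bound has to serve all indices $m = n-r$ coming from the coefficients of $F^{(r)}v$ with $r
    < n$. *)
Lemma corner_neg_uniform l n : exists M, forall m mu, (0 < m <= n)%N -> (M <= mu)%N ->
  neg_laurent qq (idpmx qq (kappa l) mu (~~ odd mu) m 0 0).
Proof.
elim: n => [|n [M HM]]; first by exists 0%N => m mu; lia.
have [M' HM'] := idpmx_corner_neg qq_neq0 qq_nonroot (laurent_kappa l) (ltn0Sn n).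
exists (maxn M M') => m mu /andP[m0]; rewrite leq_eqVlt geq_max => /predU1P[->|mn] /andP[M1 M2].
  exact: HM'.
by apply: HM => //; rewrite m0.
Qed.

Lemma tdot_is_icb l n : exists L0, forall lam, (L0 <= lam)%N ->
  is_icb l (2 * lam).+1 n (act l (2 * lam).+1 (tdot n) (vplus (2 * lam).+1)).
Proof.
(* The coefficient in row [r] is a corner coefficient of L(mu - r); the summand [n] keeps $\mu-r \ge
   M$. *)
have [M HM] := corner_neg_uniform l n; exists (M + n)%N => lam Hlam.
split; first by lia.
split; first by exists (tdot n); split=> //; rewrite tdot_idp psi_idp.
move=> r; rewrite act_vplus tdot_idp.
have odd_mu : odd (2 * lam).+1 by rewrite /= mul2n odd_double.
have := idpmx_coef qq_neq0 qq_nonroot (kappa l) n (ltn_ord r).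
have -> : Ordinal (ltn_ord r) = r by apply: val_inj.
rewrite odd_mu /idpmx => ->; split; last split.
- by move=> /eqP ->; rewrite leqnn subnn idp0 rmorph1 mxE.
- by move=> rn; rewrite ltnW //; apply: HM; lia.
- by move=> nr; rewrite leqNgt nr.
Qed.

Theorem theorem5p7 (l : int) :
  (forall n : nat, exists L0 : nat, forall lam : nat, (L0 <= lam)%N ->
     exists a : nat,
       is_icb l (2 * lam).+1 a (act l (2 * lam).+1 (tdot n) (vplus (2 * lam).+1)))
  /\ is_icanonical_basis_odd l tdot
  /\ is_A_basis_AUodd l tdot.
Proof.
split; [|split; [|split; [|split]]].
- by move=> n; have [L0 HL0] := tdot_is_icb l n; exists L0 => lam /HL0; exists n.
- by move=> n; split; [apply: tdot_in_AUodd | apply: tdot_is_icb].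
- exact: tdot_in_AUodd.
- move=> N c _ sum0; apply: (idp_lin_indep qq_neq0 qq_nonroot (b := false)).
  by rewrite -[RHS]sum0; apply: eq_bigr => i _; rewrite tdot_idp.
- move=> x Ax.
  have [|N [c [Lc xE]]] := idp_laurent_span qq_neq0 qq_nonroot (x := x) (laurent_kappa l).
    (* Integrality is tested on $v^+$, which lies in the lattice. *)
    by move=> mu r mu_odd; rewrite -act_vplus; apply: Ax => //; apply: in_LA_vplus.
  exists N, c; split=> //; rewrite xE; apply: eq_bigr => i _.
  by rewrite tdot_idp.
Qed.
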